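(* Let $k$ be a finite field, let $\mathcal{A}$, $\mathcal{B}$, $\mathcal{C}$ be commutative algebraic groups over $k$, and let $$0 \to \mathcal{B} \stackrel{\iota}{\longrightarrow} \mathcal{C} \stackrel{\pi}{\longrightarrow} \mathcal{A} \to 0$$ be an exact sequence in which $\iota$ and $\pi$ are separable homomorphisms of algebraic groups defined over $k$, and in which the maps $\iota$, $\pi$ and $\iota^{-1}$ (where it is defined, i.e. on the image of $\iota$) are explicit. Let $\mathcal{G}$ be a subgroup of $\mathcal{C}(k)$ of prime order $l$. If $\mathcal{G}$ is contained in $\iota(\mathcal{B})$, then the discrete logarithm problem in $\mathcal{G}$ reduces to the discrete logarithm problem in a subgroup of order $l$ in $\mathcal{B}(k)$. Otherwise, the discrete logarithm problem in $\mathcal{G}$ reduces to the discrete logarithm problem in a subgroup of order $l$ in $\mathcal{A}(k)$.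
   Context: All algebraic groups are commutative and written additively, and all varieties are nonsingular $k$-varieties. A morphism of algebraic groups is called explicit if it may be evaluated in polynomial time. The data $(\mathcal{C},\iota,\pi)$ as in the claim is called an extension of $\mathcal{A}$ by $\mathcal{B}$. The discrete logarithm problem (DLP) in a finite cyclic group is: given an element $g$ and an element $h$ of the subgroup $\langle g\rangle$, find the integer $x$ with $0 \le x < \mathrm{ord}(g)$ and $h = xg$. The DLP in a group $\mathcal{G}$ reduces to the DLP in a group $\mathcal{H}$ if an algorithm solving the DLP in $\mathcal{H}$ can be used to solve the DLP in $\mathcal{G}$ with polynomial-time overhead. *)

(* Defs.v *)
From Stdlib Require Import BinNums.
From mathcomp Require Import all_boot all_order all_algebra.
From mathcomp Require Import mpoly.

Set Implicit Arguments.
Unset Strict Implicit.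
Unset Printing Implicit Defensive.

Import GRing.Theory.
Local Open Scope ring_scope.

(** * Varieties over a perfect field k, as sets of points over K = kbar

   A variety is given in the classical (Weil, Serre) way: a set T of geometric
   points, covered by finitely many charts, each identified by its coordinates
   with a closed subset of an affine space, the gluing maps being regular.  The
   k-structure lies in the fact that all the polynomials involved have their
   coefficients in k.  Varieties are reduced and separated, but not assumed
   irreducible, affine or projective. *)

Record atlas (K : fieldType) (T : Type) := Atlas {
  chart : finType;
  cdim : chart -> nat;
  dom : chart -> T -> Prop;
  (* only meaningful on the domain of the chart *)
  coord : forall a : chart, T -> 'rV[K]_(cdim a)
}.

Section Varieties.

Variables (k K : fieldType) (emb : {rmorphism k -> K}).

Definition evalK n (f : {mpoly K[n]}) (x : 'rV[K]_n) : K :=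
  f.@[fun j => x 0 j].

Definition evalk n (f : {mpoly k[n]}) (x : 'rV[K]_n) : K :=
  evalK (map_mpoly emb f) x.

Definition kclosed n (V : 'rV[K]_n -> Prop) : Prop :=
  exists s : seq {mpoly k[n]},
    forall x, V x <-> all (fun f => evalk f x == 0) s.

(* Around each point, phi is given in coordinates by fractions f_j / h of
   polynomials over k with a common denominator.  That phi maps the open set
   h != 0 of the chart a into the chart b makes phi continuous. *)
Definition regular T U (X : atlas K T) (Y : atlas K U) (phi : T -> U) : Prop :=
  forall (p : T) (a : chart X) (b : chart Y), dom a p -> dom b (phi p) ->
  exists (h : {mpoly k[cdim a]}) (f : 'I_(cdim b) -> {mpoly k[cdim a]}),
    evalk h (coord a p) != 0 /\
    forall q, dom a q -> evalk h (coord a q) != 0 ->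
      dom b (phi q) /\
      forall j, coord b (phi q) 0 j
                = evalk (f j) (coord a q) / evalk h (coord a q).

Record is_variety T (X : atlas K T) : Prop := IsVariety {
  variety_cover : forall p : T, exists a : chart X, dom a p;
  variety_inj : forall (a : chart X) p q,
    dom a p -> dom a q -> coord a p = coord a q -> p = q;
  variety_affine : forall a : chart X,
    kclosed (fun x => exists2 p, dom a p & coord a p = x);
  (* the intersection of two charts is open in both, and the changes of
     coordinates are regular *)
  variety_glue : regular X X id;
  variety_separated : forall a b : chart X,
    kclosed (fun z : 'rV[K]_(cdim a + cdim b) =>
      exists p, [/\ dom a p, dom b p & z = row_mx (coord a p) (coord b p)])
}.

Definition prod_atlas T U (X : atlas K T) (Y : atlas K U) : atlas K (T * U) :=
  @Atlas K (T * U)%type (chart X * chart Y)%type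
    (fun ab => cdim ab.1 + cdim ab.2)%N
    (fun ab p => dom ab.1 p.1 /\ dom ab.2 p.2)
    (fun ab p => row_mx (coord ab.1 p.1) (coord ab.2 p.2)).

(* p belongs to X(k) *)
Definition rational T (X : atlas K T) (p : T) : Prop :=
  exists2 a : chart X, dom a p & forall j, exists x : k, coord a p 0 j = emb x.

Definition closed_in T (X : atlas K T) (Z : T -> Prop) : Prop :=
  forall a : chart X, exists s : seq {mpoly K[cdim a]},
    forall p, dom a p -> (Z p <-> all (fun f => evalK f (coord a p) == 0) s).

Definition irreducible_in T (X : atlas K T) (Z : T -> Prop) : Prop :=
  (exists p, Z p) /\
  forall Z1 Z2, closed_in X Z1 -> closed_in X Z2 ->
    (forall p, Z p -> Z1 p \/ Z2 p) ->
    (forall p, Z p -> Z1 p) \/ (forall p, Z p -> Z2 p).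

Definition chain_at T (X : atlas K T) (p : T) (d : nat) : Prop :=
  exists Z : nat -> T -> Prop,
    (forall i, (i <= d)%N ->
       [/\ closed_in X (Z i), irreducible_in X (Z i) & Z i p]) /\
    (forall i, (i < d)%N ->
       (forall q, Z i q -> Z i.+1 q) /\ exists2 q, Z i.+1 q & ~ Z i q).

(* d is the Krull dimension of the local ring of X at p *)
Definition local_dim T (X : atlas K T) (p : T) (d : nat) : Prop :=
  chain_at X p d /\ ~ chain_at X p d.+1.

Definition tangent T (X : atlas K T) (a : chart X) (p : T)
    (v : 'rV[K]_(cdim a)) : Prop :=
  forall f : {mpoly K[cdim a]},
    (forall q, dom a q -> evalK f (coord a q) = 0) ->
    \sum_(j < cdim a) evalK (mderiv j f) (coord a p) * v 0 j = 0.

Definition nonsingular_at T (X : atlas K T) (p : T) : Prop :=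
  forall a : chart X, dom a p ->
  exists (d : nat) (M : 'M[K]_(d, cdim a)),
    [/\ local_dim X p d, row_free M
      & forall v, tangent p v <-> (v <= M)%MS].

(** * Commutative algebraic groups over k *)

Record comm_alg_group := CommAlgGroup {
  point :> zmodType;
  group_atlas : atlas K point;
  group_variety : is_variety group_atlas;
  group_nonsingular : forall p, nonsingular_at group_atlas p;
  group_add_regular : regular (prod_atlas group_atlas group_atlas) group_atlas
                        (fun pq => pq.1 + pq.2);
  group_opp_regular : regular group_atlas group_atlas (fun p => - p);
  group_zero_rational : rational group_atlas 0
}.

Definition group_rational (G : comm_alg_group) : G -> Prop :=
  rational (group_atlas G).

Definition id_component (G : comm_alg_group) (p : G) : Prop :=
  exists Z : G -> Prop,
    [/\ closed_in (group_atlas G) Z, irreducible_in (group_atlas G) Z,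
        Z 0 & Z p].

(** Separability.  A rational function in n coordinates is a fraction
   num / den of polynomials. *)

Definition ratfun n := ({mpoly K[n]} * {mpoly K[n]})%type.

Definition rat_defined n (r : ratfun n) (x : 'rV[K]_n) : Prop :=
  evalK r.2 x != 0.

Definition rat_eval n (r : ratfun n) (x : 'rV[K]_n) : K :=
  evalK r.1 x / evalK r.2 x.

(* Let P be an irreducible set, x and y regular maps from P to affine spaces,
   L and F the fields of rational functions on P generated by the coordinates
   of x and of y.  The elements f_1(y), ..., f_m(y) of F are linearly
   independent over the field of p-th powers of elements of L. *)
Definition pth_free (T : Type) (P : T -> Prop)
    n (x : T -> 'rV[K]_n) n' (y : T -> 'rV[K]_n')
    (p m : nat) (f : 'I_m -> ratfun n') : Prop :=
  forall g : 'I_m -> ratfun n,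
    (forall i, exists2 q, P q & rat_defined (g i) (x q)) ->
    (forall q, P q ->
       (forall i, rat_defined (g i) (x q) /\ rat_defined (f i) (y q)) ->
       \sum_(i < m) rat_eval (g i) (x q) ^+ p * rat_eval (f i) (y q) = 0) ->
    forall i q, P q -> rat_defined (g i) (x q) -> rat_eval (g i) (x q) = 0.

(* The homomorphism phi is separable, as a map onto its image: with L = K(X0)
   the function field of the identity component X0 of G and F = K(phi(X0)),
   the extension L / F is separable, i.e. L^p and F are linearly disjoint over
   F^p. *)
Definition separable (G H : comm_alg_group) (phi : G -> H) : Prop :=
  forall (a : chart (group_atlas G)) (b : chart (group_atlas H)),
    dom a 0 -> dom b (phi 0) ->
  let P q := [/\ id_component q, dom a q & dom b (phi q)] in
  let x q := coord a q in
  let y q := coord b (phi q) in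
  forall p, p \in [pchar K] ->
  forall (m : nat) (f : 'I_m -> ratfun (cdim b)),
    (forall i, exists2 q, P q & rat_defined (f i) (y q)) ->
    pth_free P y y p f -> pth_free P x y p f.

End Varieties.

(* 0 -> B -> C -> A -> 0 is exact, on points over the algebraic closure *)
Definition short_exact (A B C : zmodType) (iota : B -> C) (pi : C -> A) : Prop :=
  [/\ injective iota,
      forall c, pi c = 0 <-> exists b, c = iota b
    & forall a, exists c, pi c = a].

(** * Computations

   Programs compute on binary trees.  The cost of a computation counts, at each
   step, the sizes of the trees that are read and written, so that running
   times are polynomially related to those of Turing machines. *)

Inductive data := Leaf | Node of data & data.

Fixpoint dsize (d : data) : nat :=
  if d is Node u v then (dsize u + dsize v).+1 else 1%N.

Inductive prog :=
  | PId | PLeaf | PHd | PTl | PAsk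
  | PNode of prog & prog
  | PComp of prog & prog          (* PComp p q runs p, then q *)
  | PIf of prog & prog & prog
  | PWhile of prog & prog.

Definition hd (d : data) := if d is Node u _ then u else Leaf.
Definition tl (d : data) := if d is Node _ v then v else Leaf.

(* run O p d e t: with oracle O, the program p on input d outputs e at cost t.
   A call outside the domain of the oracle never returns.  Tests consider Leaf
   as false, and any Node as true. *)
Inductive run (O : data -> option data) : prog -> data -> data -> nat -> Prop :=
  | RunId d : run O PId d d (dsize d)
  | RunLeaf d : run O PLeaf d Leaf (dsize d)
  | RunHd d : run O PHd d (hd d) (dsize d)
  | RunTl d : run O PTl d (tl d) (dsize d)
  | RunAsk d e : O d = Some e -> run O PAsk d e (dsize d + dsize e)
  | RunNode p q d u v s t : run O p d u s -> run O q d v t ->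
      run O (PNode p q) d (Node u v) (s + t + dsize d + dsize u + dsize v)
  | RunComp p q d u e s t : run O p d u s -> run O q u e t ->
      run O (PComp p q) d e (s + t + dsize d)
  | RunIfTrue c p q d u v e s t : run O c d (Node u v) s -> run O p d e t ->
      run O (PIf c p q) d e (s + t + dsize d)
  | RunIfFalse c p q d e s t : run O c d Leaf s -> run O q d e t ->
      run O (PIf c p q) d e (s + t + dsize d)
  | RunWhileTrue c p d u v e f r s t : run O c d (Node u v) r ->
      run O p d e s -> run O (PWhile c p) e f t ->
      run O (PWhile c p) d f (r + s + t + dsize d)
  | RunWhileFalse c p d s : run O c d Leaf s ->
      run O (PWhile c p) d d (s + dsize d).

Definition no_oracle (_ : data) : option data := None.

(* Binary digits, least significant first. *)
Fixpoint data_of_pos (n : positive) : data :=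
  match n with
  | xH => Node (Node Leaf Leaf) Leaf
  | xO m => Node Leaf (data_of_pos m)
  | xI m => Node (Node Leaf Leaf) (data_of_pos m)
  end.

Definition data_of_nat (n : nat) : data :=
  if bin_of_nat n is Npos m then data_of_pos m else Leaf.

(* Representation of the k-rational points of G by data; a point may have
   several representatives, as with homogeneous coordinates. *)
Record representation (k K : fieldType) (emb : {rmorphism k -> K})
    (G : comm_alg_group emb) := Representation {
  rep :> data -> G -> Prop;
  rep_fun : forall d p q, rep d p -> rep d q -> p = q;
  rep_rational : forall p, group_rational p -> exists d, rep d p
}.

(** Asymptotic notions need infinite families: i ranges over a set I of
   problem instances, and dsc i is a description of the i-th instance (field,
   groups, maps), which is part of the input of the algorithms. *)

(* The partial maps with graphs R i, restricted to rational points, may be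
   evaluated in polynomial time. *)
Definition explicit (I : Type) (dsc : I -> data) (k K : I -> fieldType)
    (emb : forall i, {rmorphism k i -> K i})
    (G H : forall i, comm_alg_group (emb i))
    (repG : forall i, representation (G i))
    (repH : forall i, representation (H i))
    (R : forall i, G i -> H i -> Prop) : Prop :=
  exists (p : prog) (c : nat),
  forall i (x : G i) (y : H i) (d : data),
    group_rational x -> R i x y -> repG i d x ->
    exists (e : data) (t : nat),
      [/\ run no_oracle p (Node (dsc i) d) e t, repH i e y
        & (t <= c * dsize (Node (dsc i) d) ^ c)%N].

(** * Discrete logarithms *)

Definition subgroup_of_order (V : zmodType) (P : V -> Prop) (G : {pred V})
    (l : nat) : Prop :=
  [/\ zmod_closed G, forall g, g \in G -> P g
    & exists2 s : seq V, uniq s /\ size s = l & G =i s].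

Definition has_order (V : zmodType) (g : V) (n : nat) : Prop :=
  [/\ (0 < n)%N, g *+ n = 0 & forall m, (0 < m < n)%N -> g *+ m != 0].

Definition dlog (V : zmodType) (g h : V) (x : nat) : Prop :=
  exists2 n, has_order g n & (x < n)%N /\ h = g *+ x.

(* The input of the DLP in the i-th group, for elements represented by dg, dh *)
Definition dlp_input (dsc dg dh : data) : data := Node dsc (Node dg dh).

Definition oracle_solves_dlp (dsc : data) (V : zmodType)
    (r : data -> V -> Prop) (G : {pred V}) (O : data -> option data) : Prop :=
  forall (g h : V) (x : nat) (dg dh : data),
    g \in G -> h \in G -> dlog g h x -> r dg g -> r dh h ->
    O (dlp_input dsc dg dh) = Some (data_of_nat x).

(* The DLP in the groups G i of order l i reduces to the DLP in the groups H i,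
   for the instances i satisfying S.  Besides the length of the input, time is
   measured in terms of the length of l i, i.e. of the largest discrete
   logarithms. *)
Definition dlp_reduces (I : Type) (S : I -> Prop) (dsc : I -> data)
    (l : I -> nat)
    (V : I -> zmodType) (rV : forall i, data -> V i -> Prop)
    (G : forall i, {pred V i})
    (W : I -> zmodType) (rW : forall i, data -> W i -> Prop)
    (H : forall i, {pred W i}) : Prop :=
  exists (p : prog) (c : nat),
  forall i, S i ->
  forall O, oracle_solves_dlp (dsc i) (rW i) (H i) O ->
  forall (g h : V i) (x : nat) (dg dh : data),
    g \in G i -> h \in G i -> dlog g h x -> rV i dg g -> rV i dh h ->
    exists2 t,
      run O p (dlp_input (dsc i) dg dh) (data_of_nat x) t &
      (t <= c * (dsize (dlp_input (dsc i) dg dh)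
                 + dsize (data_of_nat (l i))) ^ c)%N.

(* Main.v *)
(** A group G of prime order that is not contained in iota(B) = ker pi meets
  ker pi trivially, so pi is injective on it; iota^-1 is injective on any G in
  iota(B).  In both cases discrete logarithms are preserved, and one call to
  the oracle on the transported pair suffices.  The preimage of G in B consists
  of k-rational points because Frobenius commutes with the injective map iota,
  so that it fixes b whenever it fixes iota(b). *)

From HB Require Import structures.
From Stdlib Require Import ClassicalEpsilon.
From mathcomp Require Import all_boot all_order all_algebra.
From mathcomp Require Import finfield mpoly zify.
Require Import Defs.

Set Implicit Arguments.
Unset Strict Implicit.
Unset Printing Implicit Defensive.

Import GRing.Theory.
Local Open Scope ring_scope.

(** * Frobenius and rational points *)

(** Take [sigma z = z ^+ q] with [q = #|k|], additive because [q] is a power of the characteristic.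
    Its fixed points are the roots of X^q - X, which splits over [k] as the product of the X - x. *)
Lemma frobenius_fixed_field (k : finFieldType) (K : fieldType)
    (emb : {rmorphism k -> K}) :
  exists sigma : {rmorphism K -> K}, forall z, sigma z = z <-> exists x, z = emb x.
Proof.
have [p p_prime charkp] := finPcharP k.
have charK_q : [pchar K].-nat #|k|.
  have charKp := rmorph_pchar emb charkp.
  by rewrite (card_pprimeChar charkp) pnatX pnatE ?charKp.
pose q := #|k|.
have add_q : zmod_morphism (fun z : K => z ^+ q).
  by move=> x y; rewrite exprDn_pchar // exprNn_pchar.
have mul_q : monoid_morphism (fun z : K => z ^+ q).
  by split=> [|x y]; rewrite ?expr1n ?exprMn.
pose addI := GRing.isZmodMorphism.Build K K _ add_q.
pose mulI := GRing.isMonoidMorphism.Build K K _ mul_q.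
pose sigma : {rmorphism K -> K} := HB.pack (fun z : K => z ^+ q) addI mulI.
exists sigma => z /=; split=> [zq | [x ->]]; last by rewrite -rmorphXn expf_card.
have /(congr1 (fun f => (map_poly emb f).[z])) := finField_genPoly k.
rewrite rmorphB /= map_polyXn map_polyX !hornerE zq subrr rmorph_prod horner_prod.
move/esym/eqP/prodf_eq0 => [x _].
by rewrite rmorphB /= map_polyX map_polyC !hornerE subr_eq0 => /eqP; exists x.
Qed.

Lemma evalk_map (k K : fieldType) (emb : {rmorphism k -> K})
    (sigma : {rmorphism K -> K}) (n : nat) (f : {mpoly k[n]}) (x : 'rV[K]_n) :
  (forall c, sigma (emb c) = emb c) ->
  evalk emb f (map_mx sigma x) = sigma (evalk emb f x).
Proof.
move=> fix_k; rewrite /evalk /evalK !mevalE rmorph_sum; apply: eq_bigr => m _.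
rewrite rmorphM rmorph_prod /= mcoeff_map_mpoly fix_k; congr (_ * _).
by apply: eq_bigr => j _; rewrite mxE rmorphXn.
Qed.

(** Frobenius fixes the coordinates of [p], hence also the fractions over [k] that give those of
    [phi p]. *)
Lemma rational_regular (k : finFieldType) (K : fieldType)
    (emb : {rmorphism k -> K}) T U (X : atlas K T) (Y : atlas K U)
    (phi : T -> U) (p : T) :
  is_variety emb Y -> regular emb X Y phi ->
  rational emb X p -> rational emb Y (phi p).
Proof.
move=> varY reg [a pa p_k]; have [b pb] := variety_cover varY (phi p).
have [sigma fixP] := frobenius_fixed_field emb.
have fix_k c : sigma (emb c) = emb c by apply/fixP; exists c.
have fix_p : map_mx sigma (coord a p) = coord a p.
  by apply/rowP => j; rewrite mxE; apply/fixP/p_k.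
have [h [f [hp eval_phi]]] := reg p a b pa pb.
have [_ phiE] := eval_phi p pa hp.
exists b => // j; apply/fixP.
by rewrite phiE rmorphM fmorphV -!evalk_map // fix_p.
Qed.

(* Frobenius acts on the points of X and commutes with phi; it fixes p because
   it fixes phi p. *)
Lemma rational_of_regular_injective (k : finFieldType) (K : fieldType)
    (emb : {rmorphism k -> K}) T U (X : atlas K T) (Y : atlas K U)
    (phi : T -> U) (p : T) :
  is_variety emb X -> is_variety emb Y -> regular emb X Y phi ->
  injective phi -> rational emb Y (phi p) -> rational emb X p.
Proof.
move=> varX varY reg phi_inj [b pb phip_k].
have [a pa] := variety_cover varX p.
have [sigma fixP] := frobenius_fixed_field emb.
have fix_k c : sigma (emb c) = emb c by apply/fixP; exists c.
have [h [f [hp eval_phi]]] := reg p a b pa pb.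
have [s closedX] := variety_affine varX a.
have : all (fun g => evalk emb g (coord a p) == 0) s by apply/closedX; exists p.
move=> s_p.
(* The image of the chart is cut out by equations over [k], so it contains the Frobenius conjugate
   of [coord a p], which is thus the coordinate vector of a point [p']. *)
have [|p' p'a p'E] := (closedX (map_mx sigma (coord a p))).2.
  apply: sub_all s_p => g /eqP gp.
  by rewrite evalk_map // gp rmorph0.
have hp' : evalk emb h (coord a p') != 0 by rewrite p'E evalk_map // fmorph_eq0.
have [_ phiE] := eval_phi p pa hp; have [p'b phi'E] := eval_phi p' p'a hp'.
have pp' : p' = p.
  apply/phi_inj/(variety_inj varY p'b pb)/rowP => j.
  rewrite phi'E p'E !evalk_map // -fmorphV -rmorphM -phiE.
  exact/fixP/phip_k.
exists a => // j; apply/fixP.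
by rewrite -[in RHS]pp' p'E mxE.
Qed.

(** * Running times and sizes of encodings *)

Lemma run_no_oracle O p d e t : run no_oracle p d e t -> run O p d e t.
Proof.
by elim=> *; try discriminate; econstructor; eauto.
Qed.

Lemma dsize_gt0 d : (0 < dsize d)%N.
Proof. by case: d. Qed.

(** Every tree that is written is paid for by its size. This bounds an oracle query by the time
    spent computing its parts. *)
Lemma dsize_output O p d e t : run O p d e t -> (dsize e <= t)%N.
Proof.
elim=> {p d e t} [d|[|u v]|[|u v]|[|u v]||p q d|||||] * /=; try lia.
(* Case [PNode]: the charge for the input [d] covers the new root. *)
by have := dsize_gt0 d; lia.
Qed.

(** A smaller number has no more digits, and a nonleading digit adds 2 to the size if it is 0 and 4
    if it is 1; hence the factor 2. *)
Lemma dsize_data_of_pos m n :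
  (nat_of_pos m <= nat_of_pos n -> dsize (data_of_pos m) <= 2 * dsize (data_of_pos n))%N.
Proof.
have pos_gt0 p : (0 < nat_of_pos p)%N by elim: p => //= p; rewrite NatTrec.doubleE; lia.
elim: n m => [n IH|n IH|] [m|m|] //=; rewrite ?NatTrec.doubleE => le_mn.
- by have := IH m; lia.
- by have := IH m; lia.
- by lia.
- by have := IH m; lia.
- by have := IH m; lia.
- by have := dsize_gt0 (data_of_pos n); lia.
- by have := pos_gt0 m; lia.
- by have := pos_gt0 m; lia.
Qed.

(* The encoding is not monotone in size: a digit 1 is longer than a digit 0. *)
Lemma dsize_data_of_nat m n :
  (m <= n -> dsize (data_of_nat m) <= 2 * dsize (data_of_nat n))%N.
Proof.
rewrite -{1}(bin_of_natK m) -{1}(bin_of_natK n) /data_of_nat.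
case: (bin_of_nat m) (bin_of_nat n) => [|m'] [|n'] //=; last exact: dsize_data_of_pos.
  by have := dsize_gt0 (data_of_pos n'); lia.
by elim: m' => //= m' IH; rewrite NatTrec.doubleE; lia.
Qed.

(** The projections assemble the two inputs of [p]: the description paired with each element. The
    oracle's answer is returned unchanged, since transport preserves logarithms. *)
Definition transport_dlp (p : prog) : prog :=
  PComp (PNode PHd (PNode (PComp (PNode PHd (PComp PTl PHd)) p)
                          (PComp (PNode PHd (PComp PTl PTl)) p))) PAsk.

(** The trees handled are boundedly many copies of parts of the input and of [eg] and [eh], whose
    sizes are at most [s] and [t]; 20 is a generous count. The answer [e] is charged once, by
    [PAsk]. *)
Lemma run_transport_dlp O p ds dg dh eg eh e s t :
  run O p (Node ds dg) eg s -> run O p (Node ds dh) eh t ->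
  O (dlp_input ds eg eh) = Some e ->
  exists2 r, run O (transport_dlp p) (dlp_input ds dg dh) e r &
    (r <= 20 * (dsize (dlp_input ds dg dh) + s + t) + dsize e)%N.
Proof.
move=> run_g run_h ask.
have eg_s := dsize_output run_g; have eh_t := dsize_output run_h.
eexists.
  apply: RunComp (RunAsk ask); apply: RunNode (RunHd _ _) _; apply: RunNode.
    apply: RunComp run_g; apply: RunNode (RunHd _ _) _.
    exact: RunComp (RunTl _ _) (RunHd _ _).
  apply: RunComp run_h; apply: RunNode (RunHd _ _) _.
  exact: RunComp (RunTl _ _) (RunTl _ _).
by rewrite /dlp_input /=; lia.
Qed.

(** Here [N] is the input size and [m] the size of the group order. Then [r] is at most 20 (N + m) +
    40 c N^c, and 20 + 40 c serves both as factor and as exponent, as [dlp_reduces] has one constant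
    for both. *)
Lemma transport_dlp_time c N m s t r :
  (0 < N -> s <= c * N ^ c -> t <= c * N ^ c ->
   r <= 20 * (N + s + t) + 2 * m ->
   r <= (20 + 40 * c) * (N + m) ^ (20 + 40 * c))%N.
Proof.
move=> N_gt0 le_s le_t le_r.
set E := (20 + 40 * c)%N.
have le_pow a : (a <= E -> N ^ a <= (N + m) ^ E)%N.
  move=> le_aE; apply: (@leq_trans ((N + m) ^ a)%N).
    by case: a le_aE => // a _; rewrite leq_exp2r // leq_addr.
  by rewrite leq_pexp2l //; lia.
have le_id : (N + m <= (N + m) ^ E)%N.
  by rewrite -{1}(expn1 (N + m)) leq_pexp2l //; lia.
have : (c * N ^ c <= c * (N + m) ^ E)%N.
  by rewrite leq_mul2l le_pow ?orbT // /E; lia.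
move: ((N + m) ^ E)%N le_id => X; rewrite /E mulnDl -mulnA.
by move: (c * X)%N (c * N ^ c)%N le_s le_t => *; lia.
Qed.

(** * Subgroups of prime order *)

(** Translation by [g] permutes [G]; comparing the sums of all elements before and after gives l g =
    0. *)
Lemma mulrn_subgroup_order (V : zmodType) P (G : {pred V}) l g :
  subgroup_of_order P G l -> g \in G -> g *+ l = 0.
Proof.
move=> [[G0 GB] _ [s [uniq_s size_s] Gs]] gG.
have perm_sg : perm_eq [seq g + x | x <- s] s.
  apply: uniq_perm => //; first by rewrite map_inj_uniq //; apply: addrI.
  move=> x; rewrite -Gs; apply/mapP/idP => [[y]|xG].
    by rewrite -Gs => yG ->; rewrite -[y]opprK -[- y]sub0r !GB.
  by exists (x - g); [rewrite -Gs GB | rewrite addrC subrK].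
have : \sum_(x <- s) (g + x) = \sum_(x <- s) x.
  by rewrite -[RHS](perm_big _ perm_sg) big_map.
rewrite big_split /= big_const_seq count_predT size_s iter_addr addr0.
by move/(canRL (addrK _)); rewrite subrr.
Qed.

Lemma mulrn_subgroup (V : zmodType) (G : {pred V}) g n :
  zmod_closed G -> g \in G -> g *+ n \in G.
Proof.
move=> [G0 GB] gG; elim: n => // n IH.
by rewrite mulrS -[g *+ n]opprK -[- (g *+ n)]sub0r !GB.
Qed.

(** No positive multiple of [g] below the [l]-th vanishes, so the first [l] multiples are distinct
    and fill [G]. *)
Lemma prime_subgroup_generated (V : zmodType) P (G : {pred V}) l g h :
  subgroup_of_order P G l -> prime l -> g \in G -> g != 0 -> h \in G ->
  exists n, h = g *+ n.
Proof.
move=> sG l_prime gG g_neq0 hG.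
have gl := mulrn_subgroup_order sG gG.
have [zG _ [s [uniq_s size_s] Gs]] := sG.
have no_small m : (0 < m < l)%N -> g *+ m != 0.
  move=> /andP[m_gt0 lt_ml]; apply: contraNneq g_neq0 => gm.
  have cop : coprime m l.
    rewrite coprime_sym prime_coprime //; apply/negP => /(dvdn_leq m_gt0); lia.
  (* Bézout: u m = v l + 1, while m g = l g = 0, so g = 0. *)
  have [u v uv _] := egcdnP l m_gt0.
  have : g *+ (v * l + 1) = g *+ (u * m) by rewrite uv (eqP cop).
  by rewrite mulrnDr mulr1n [(v * l)%N]mulnC [(u * m)%N]mulnC !mulrnA gm gl !mul0rn add0r => ->.
have uniq_t : uniq [seq g *+ i | i <- iota 0 l].
  rewrite map_inj_in_uniq ?iota_uniq // => i j; rewrite !mem_iota.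
  wlog le_ij : i j / (i <= j)%N.
    by move=> W ii jj ij; case/orP: (leq_total i j) => le; [|symmetry]; apply: W.
  move=> ii jj eq_ij; apply/eqP; rewrite eqn_leq le_ij /= leqNgt.
  apply/negP => lt_ij; have /no_small/eqP : (0 < j - i < l)%N by lia.
  by rewrite mulrnBr // eq_ij subrr.
have sub_ts : {subset [seq g *+ i | i <- iota 0 l] <= s}.
  by move=> _ /mapP[i _ ->]; rewrite -Gs mulrn_subgroup.
have [|_ ts] := uniq_min_size uniq_t sub_ts; first by rewrite size_map size_iota size_s.
by move: hG; rewrite Gs -ts => /mapP[i _ ->]; exists i.
Qed.

Lemma order_le_card (V : zmodType) P (G : {pred V}) l g n :
  subgroup_of_order P G l -> g \in G -> has_order g n -> (n <= l)%N.
Proof.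
move=> sG gG [_ _ small]; rewrite leqNgt; apply/negP => lt_ln.
have l_gt0 : (0 < l)%N.
  by have [[G0 _] _ [[|x s] [_ <-] Gs]] := sG; rewrite // Gs in G0.
by have := small l; rewrite l_gt0 lt_ln (mulrn_subgroup_order sG) // eqxx => /(_ isT).
Qed.

(** * Transport along partial homomorphisms *)

(** Relations treat the partial map inverse to iota and the total map pi alike. Excluded middle
    supplies the Boolean value that a [{pred W}] requires. *)
Definition rel_image (V W : zmodType) (R : V -> W -> Prop) (G : {pred V}) : {pred W} :=
  fun y => excluded_middle_informative (exists2 x, x \in G & R x y).

Lemma rel_imageP (V W : zmodType) (R : V -> W -> Prop) (G : {pred V}) y :
  reflect (exists2 x, x \in G & R x y) (y \in rel_image R G).
Proof. exact: sumboolP. Qed.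

(** Closure under differences reduces equality to vanishing, so [R_ker] makes [R] both functional
    and injective on [G]. *)
Lemma rel_image_subgroup (V W : zmodType) (R : V -> W -> Prop)
    (P : V -> Prop) (Q : W -> Prop) (G : {pred V}) (l : nat) :
  subgroup_of_order P G l ->
  (forall x y x' y', R x y -> R x' y' -> R (x - x') (y - y')) ->
  (forall g, g \in G -> exists y, R g y) ->
  (forall g y, g \in G -> R g y -> (g = 0 <-> y = 0)) ->
  (forall x y, R x y -> P x -> Q y) ->
  subgroup_of_order Q (rel_image R G) l.
Proof.
move=> [[G0 GB] GP [s [uniq_s size_s] Gs]] R_sub R_total R_ker R_PQ.
have R00 : R 0 0.
  by have [y Ry] := R_total 0 G0; have := R_sub _ _ _ _ Ry Ry; rewrite !subrr.
have R_eq x y x' y' : x \in G -> x' \in G -> R x y -> R x' y' -> x = x' <-> y = y'.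
  move=> xG x'G Rxy Rx'y'; have ker := R_ker _ _ (GB _ _ xG x'G) (R_sub _ _ _ _ Rxy Rx'y').
  by split=> [eq_x|eq_y]; apply: subr0_eq; apply/ker; rewrite ?eq_x ?eq_y subrr.
split.
- split=> [|y y' /rel_imageP[x xG Rx] /rel_imageP[x' x'G Rx']].
    by apply/rel_imageP; exists 0.
  by apply/rel_imageP; exists (x - x'); [apply: GB | apply: R_sub].
- by move=> y /rel_imageP[x /GP Px /R_PQ]; apply.
(* [t] lists partners of the elements of [s] in the same order, so that distinctness and membership
   transfer index by index. *)
have : exists2 t : seq W, size t = size s &
    forall i, (i < size s)%N -> R (nth 0 s i) (nth 0 t i).
  (* Only the inclusion of [s] in [G] is kept, as it passes to tails. *)
  have {uniq_s size_s}: {subset s <= G} by move=> x; rewrite Gs.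
  elim: s {Gs} => [|x s IH] sG; first by exists [::].
  have [y Rxy] := R_total x (sG _ (mem_head _ _)).
  have [x' x's|t size_t Rst] := IH; first by rewrite sG // in_cons x's orbT.
  by exists (y :: t) => [|[|i]] //=; rewrite ?size_t //; apply: Rst.
move=> [t size_ts Rst]; exists t.
  split; last by rewrite size_ts.
  apply/(uniqP 0) => i j; rewrite !inE size_ts => lt_i lt_j eq_ij.
  apply/eqP; rewrite -(nth_uniq 0 lt_i lt_j uniq_s); apply/eqP.
  by apply: (R_eq _ _ _ _ _ _ (Rst i lt_i) (Rst j lt_j)).2; rewrite // Gs mem_nth.
move=> y; apply/rel_imageP/idP => [[x]|/(nthP 0)[i lt_i <-]].
  rewrite {1}Gs => /(nthP 0)[i lt_i <-] Ry.
  have iG : nth 0 s i \in G by rewrite Gs mem_nth.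
  by rewrite ((R_eq _ _ _ _ iG iG Ry (Rst i lt_i)).1 erefl) mem_nth // size_ts.
by rewrite size_ts in lt_i; exists (nth 0 s i); [rewrite Gs mem_nth | apply: Rst].
Qed.

(** Corresponding multiples of [g] and [g'] vanish together, so the two elements have the same
    order. *)
Lemma dlog_transport (V W : zmodType) (R : V -> W -> Prop) (G : {pred V})
    g h g' h' x :
  zmod_closed G ->
  (forall x y x' y', R x y -> R x' y' -> R (x - x') (y - y')) ->
  (forall g y, g \in G -> R g y -> (g = 0 <-> y = 0)) ->
  g \in G -> R g g' -> R h h' -> dlog g h x -> dlog g' h' x.
Proof.
move=> zG R_sub R_ker gG Rg Rh [n [n_gt0 gn small] [lt_xn hE]].
have R_muln m : R (g *+ m) (g' *+ m).
  have R00 : R 0 0 by have := R_sub _ _ _ _ Rg Rg; rewrite !subrr.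
  elim: m => // m; have := R_sub _ _ _ _ R00 Rg; rewrite !sub0r => RN IH.
  by have := R_sub _ _ _ _ IH RN; rewrite !opprK -!mulrSr.
have zero_muln m := R_ker _ _ (mulrn_subgroup m zG gG) (R_muln m).
exists n; first split=> //.
- exact/zero_muln.
- by move=> m /small; apply: contra_neq => /zero_muln.
split=> //; apply/eqP; rewrite -subr_eq0; apply/eqP.
(* [R] relates 0 to h' - x g', which [R_ker] forces to vanish. *)
have := R_sub _ _ _ _ Rh (R_muln x); rewrite hE subrr => /R_ker; case; [by case: zG | by move=> -> ].
Qed.

(** * The reduction *)

(** Common to both cases: [R] will be the graph of the inverse of iota or that of pi, and [S] the
    condition selecting the case. *)
Lemma dlp_reduces_along (I : Type) (S : I -> Prop) (dsc : I -> data)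
    (k K : I -> fieldType) (emb : forall i, {rmorphism k i -> K i})
    (C D : forall i, comm_alg_group (emb i))
    (repC : forall i, representation (C i))
    (repD : forall i, representation (D i))
    (R : forall i, C i -> D i -> Prop) (l : I -> nat) (G : forall i, {pred C i}) :
  explicit dsc repC repD R ->
  (forall i, subgroup_of_order (@group_rational _ _ _ (C i)) (G i) (l i)) ->
  (forall i x y x' y', R i x y -> R i x' y' -> R i (x - x') (y - y')) ->
  (forall i, S i -> forall g, g \in G i -> exists y, R i g y) ->
  (forall i, S i -> forall g y, g \in G i -> R i g y -> (g = 0 <-> y = 0)) ->
  (forall i x y, R i x y -> group_rational x -> group_rational y) ->
  exists2 H : forall i, {pred D i},
    forall i, S i -> subgroup_of_order (@group_rational _ _ _ (D i)) (H i) (l i)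
    & dlp_reduces S dsc l repC G repD H.
Proof.
move=> [p [c p_explicit]] sG R_sub R_total R_ker R_rational.
exists (fun i => rel_image (R i) (G i)) => [i Si|].
  exact: rel_image_subgroup (sG i) (R_sub i) (R_total i Si) (R_ker i Si) (R_rational i).
exists (transport_dlp p), (20 + 40 * c)%N => i Si O O_solves g h x dg dh gG hG g_h_x dg_g dh_h.
have [zG GP _] := sG i.
have [g' Rg] := R_total i Si g gG; have [h' Rh] := R_total i Si h hG.
have [eg [s [run_g eg_g' le_s]]] := p_explicit i g g' dg (GP g gG) Rg dg_g.
have [eh [t [run_h eh_h' le_t]]] := p_explicit i h h' dh (GP h hG) Rh dh_h.
have g'_h'_x := dlog_transport zG (R_sub i) (R_ker i Si) gG Rg Rh g_h_x.
have g'H : g' \in rel_image (R i) (G i) by apply/rel_imageP; exists g.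
have h'H : h' \in rel_image (R i) (G i) by apply/rel_imageP; exists h.
have ask := O_solves g' h' x eg eh g'H h'H g'_h'_x eg_g' eh_h'.
have [r run_r le_r] :=
  run_transport_dlp (run_no_oracle O run_g) (run_no_oracle O run_h) ask.
exists r => //.
have le_pow d : (dsize (Node (dsc i) d) <= dsize (dlp_input (dsc i) dg dh) ->
    c * dsize (Node (dsc i) d) ^ c <= c * dsize (dlp_input (dsc i) dg dh) ^ c)%N.
  by move=> le_d; rewrite leq_mul2l; case: (c) => // c'; rewrite leq_exp2r // le_d orbT.
apply: (transport_dlp_time _ (leq_trans le_s (le_pow dg _)) (leq_trans le_t (le_pow dh _))).
- exact: dsize_gt0.
- by rewrite /=; lia.
- by rewrite /=; lia.
(* The answer [x] is below the order of [g], hence below [l i], which bounds its encoding. *)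
apply: leq_trans le_r _; rewrite leq_add2l; apply: dsize_data_of_nat.
have [n g_n [lt_xn _]] := g_h_x.
exact: leq_trans (ltnW lt_xn) (order_le_card (sG i) gG g_n).
Qed.

Theorem proposition2p1
  (I : Type) (dsc : I -> data)
  (k : I -> finFieldType) (K : I -> closedFieldType)
  (emb : forall i, {rmorphism k i -> K i})
  (K_algebraic : forall i (z : K i), algebraicOver (emb i) z)
  (A B C : forall i, comm_alg_group (emb i))
  (iota : forall i, {additive B i -> C i})
  (pi : forall i, {additive C i -> A i})
  (iota_pi_exact : forall i, short_exact (iota i) (pi i))
  (iota_regular : forall i,
     regular (emb i) (group_atlas (B i)) (group_atlas (C i)) (iota i))
  (pi_regular : forall i,
     regular (emb i) (group_atlas (C i)) (group_atlas (A i)) (pi i))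
  (iota_separable : forall i, separable (iota i))
  (pi_separable : forall i, separable (pi i))
  (repA : forall i, representation (A i))
  (repB : forall i, representation (B i))
  (repC : forall i, representation (C i))
  (iota_explicit : explicit dsc repB repC (fun i b c => c = iota i b))
  (pi_explicit : explicit dsc repC repA (fun i c a => a = pi i c))
  (iota_inv_explicit : explicit dsc repC repB (fun i c b => c = iota i b))
  (l : I -> nat) (l_prime : forall i, prime (l i))
  (G : forall i, {pred C i})
  (G_subgroup : forall i,
     subgroup_of_order (@group_rational _ _ _ (C i)) (G i) (l i)) :
  let in_image i := forall g, g \in G i -> exists b, g = iota i b in
  (exists2 H : forall i, {pred B i},
     forall i, in_image i ->
       subgroup_of_order (@group_rational _ _ _ (B i)) (H i) (l i)
     & dlp_reduces in_image dsc l repC G repB H)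
  /\
  (exists2 H : forall i, {pred A i},
     forall i, ~ in_image i ->
       subgroup_of_order (@group_rational _ _ _ (A i)) (H i) (l i)
     & dlp_reduces (fun i => ~ in_image i) dsc l repC G repA H).
Proof.
move=> in_image; split.
- apply: (dlp_reduces_along iota_inv_explicit G_subgroup).
  + by move=> i x y x' y' -> ->; rewrite raddfB.
  + by move=> i im g /im.
  + move=> i _ g y _ ->; have [iota_inj _ _] := iota_pi_exact i.
    by split=> [|->]; rewrite ?raddf0 // -(raddf0 (iota i)) => /iota_inj.
  + move=> i x y ->; have [iota_inj _ _] := iota_pi_exact i.
    exact: rational_of_regular_injective (group_variety _) (group_variety _)
      (iota_regular i) iota_inj.
- apply: (dlp_reduces_along pi_explicit G_subgroup).
  + by move=> i x y x' y' -> ->; rewrite raddfB.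
  + by move=> i _ g _; exists (pi i g).
  + move=> i not_im g y gG ->; split=> [->|pig]; first exact: raddf0.
    (* A nonzero [g] killed by pi would generate [G] and so put all of [G] into the image of
       iota. *)
    apply/eqP/negP => /negP g_neq0; apply: not_im => h hG.
    have [n ->] := prime_subgroup_generated (G_subgroup i) (l_prime i) gG g_neq0 hG.
    have [_ ker_pi _] := iota_pi_exact i.
    by apply/ker_pi; rewrite raddfMn pig mul0rn.
  + move=> i x y ->.
    exact: rational_regular (group_variety _) (pi_regular i).
Qed.
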